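(* Let $\mathbb{F}$ be a field, $n\geq 1$ an integer, and let $A\in\mathrm{GL}_n(\mathbb{F})$ have determinant $\pm 1$. Then the matrix $A\oplus I_n\in\mathrm{GL}_{2n}(\mathbb{F})$ is the product of two involutions and one $U_2$-matrix.
   Context: $A\oplus B$ denotes the block-diagonal matrix with diagonal blocks $A$ and $B$. A matrix $S\in\mathrm{GL}_m(\mathbb{F})$ is an involution if $S^2=I_m$, and a $U_2$-matrix (unipotent of index $2$) if $(S-I_m)^2=0$; $I_m$ is both. The product is of three factors of the stated types in some order (a matrix that is such a product in one prescribed order is also such a product in any other order). *)

(* Defs.v *)
From HB Require Import structures.
From mathcomp Require Import all_boot all_order all_algebra.

Set Implicit Arguments.
Unset Strict Implicit.
Unset Printing Implicit Defensive.

Import GRing.Theory.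
Local Open Scope ring_scope.

Definition involution (F : fieldType) (m : nat) (S : 'M[F]_m) : Prop :=
  S \in unitmx /\ S *m S = 1%:M.

Definition U2_matrix (F : fieldType) (m : nat) (S : 'M[F]_m) : Prop :=
  S \in unitmx /\ (S - 1%:M) *m (S - 1%:M) = 0.

(* The factors may come in any order; as S1 and S2 are of the same type, only
   the position of U matters. *)
Definition prod_two_involutions_one_U2 (F : fieldType) (m : nat)
    (M : 'M[F]_m) : Prop :=
  exists S1 S2 U : 'M[F]_m,
    [/\ involution S1, involution S2, U2_matrix U
      & [\/ M = S1 *m S2 *m U, M = S1 *m U *m S2 | M = U *m S1 *m S2]].

(* Main.v *)
Require Import Defs.
From HB Require Import structures.
From mathcomp Require Import all_boot all_order all_algebra.
From mathcomp Require Import fingroup perm ring zify.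

Set Implicit Arguments.
Unset Strict Implicit.
Unset Printing Implicit Defensive.

Import GRing.Theory.
Local Open Scope ring_scope.

(** A matrix that an involution conjugates to its inverse is a product of two
    involutions, so it is enough to multiply a conjugate of A (+) 1 by a
    U_2-matrix and land on such a reversible matrix.

    Write A - 1 = p q with p of full column rank s and q of full row rank s.
    The s x s matrix A' = 1 + q p is the action of A on the image of A - 1, and
    det A' = det A.  Three cases arise.

    If A' is not scalar, then A' = W' X' where W' is unipotent and X' is
    unipotent except for one eigenvalue d = det A
    ([unipotent_factorization]: bring A' to a form with upper left entry 1 and
    recurse on the Schur complement).  This lifts to A = W X with W' replaced
    by W = 1 + p (W' - 1) p', where p' p = 1, so that the columns of W - 1 lie
    in the image of A - 1.  Because of this last property, a conjugate of
    A (+) 1 times a U_2-matrix equals the block triangular matrix with diagonal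
    X, W and corner W - 1 ([prod_of_factorization]).  It is unipotent, up to a
    simple eigenvalue -1 when d = -1 <> 1.  A unipotent matrix is reversible,
    because its space is a direct sum of cyclic subspaces and on each of them
    v f(g) |-> v f(g^-1) is a well-defined involution
    ([unipotent_summand_inversion]).

    If A' = 1, then (A - 1)^2 = p (q p) q = 0 and A (+) 1 is itself a
    U_2-matrix.

    If A' = b with b <> 1, then A (+) 1 is conjugate to b 1_s (+) 1_s extended
    by an identity, where b^s = det A = 1 or -1.  A conjugate of
    b 1_s (+) 1_s is the block companion matrix of x^2 - (b + 1) x + b, and a
    U_2-matrix can change the middle coefficient b + 1 into any s x s matrix T.
    The polynomial x^(2s) + b^s equals x^s D_s(x + b/x) for a (Dickson)
    polynomial D_s of degree s, so that some T turns the block companion matrix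
    into a conjugate of the cyclic shift of 2s basis vectors whose 2s-th power
    is the sign - b^s.  A signed cyclic shift is a product of two reflections, just as a rotation of a
    regular polygon is ([prod_scalar_block]). *)

(** * Unipotent matrices are products of two involutions *)

Lemma col_mulmx (R : pzSemiRingType) (m n p : nat) (A : 'M[R]_(m, n))
    (B : 'M[R]_(n, p)) (j : 'I_p) : col j (A *m B) = A *m col j B.
Proof. by rewrite !colE mulmxA. Qed.

Lemma neq0_mx_entry (R : nmodType) (m n : nat) (A : 'M[R]_(m, n)) :
  A != 0 -> exists i j, A i j != 0.
Proof.
move=> A0.
suff /existsP[i /existsP[j Aij]] : [exists i, [exists j, A i j != 0]].
  by exists i, j.
apply: contra_neqT A0 => /existsPn A0; apply/matrixP=> i j.
by have := A0 i => /existsPn/(_ j); rewrite negbK mxE => /eqP.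
Qed.

(** Write N = g - 1.  The row v generates a cyclic subspace with basis v N^i,
    i <= k, and the columns N^j w provide an invariant complement, their common
    kernel: the pairing v N^i N^j w vanishes for i + j > k and is nonzero for
    i + j = k, so it is triangular and invertible.  E1 is the corresponding
    projection.  S sends v N^i to v (h - 1)^i and kills the complement, where
    h = g^-1; on the summand, conjugation by S exchanges g and h.  The
    commuting matrix E serves to stay inside a given summand. *)
Lemma cyclic_summand_inversion (F : fieldType) (m k : nat) (g h E : 'M[F]_m)
    (v : 'rV[F]_m) (w : 'cV[F]_m) :
  g * h = 1 -> h * g = 1 -> g * E = E * g -> v *m E = v -> E *m w = w ->
  v *m (g - 1) ^+ k.+1 = 0 -> (g - 1) ^+ k.+1 *m w = 0 ->
  v *m (g - 1) ^+ k *m w != 0 ->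
  exists E1 S : 'M[F]_m,
    [/\ E1 != 0, E1 * E1 = E1, g * E1 = E1 * g, E * E1 = E1 /\ E1 * E = E1
      & [/\ S * E1 = S, E1 * S = S, S * S = E1 & g * S * g = S]].
Proof.
move=> gh hg gE vE Ew vN0 Nw0 vNw.
set N := g - 1 in vN0 Nw0 vNw; pose N' := h - 1.
have NE : E *m N = N *m E.
  by rewrite mulmxBl mulmxBr mulmx1 mul1mx; congr (_ - _); exact/esym.
have NXE i : E *m N ^+ i = N ^+ i *m E.
  have cNE : GRing.comm E N by exact: NE.
  exact: (commrX i cNE).
pose P : 'M[F]_(k.+1, m) := \matrix_(i < k.+1) (v *m N ^+ i).
pose P' : 'M[F]_(k.+1, m) := \matrix_(i < k.+1) (v *m N' ^+ i).
pose Q : 'M[F]_(m, k.+1) := \matrix_(i < m, j < k.+1) (N ^+ (k - j) *m w) i 0.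
have rowP i : row i P = v *m N ^+ i by rewrite rowK.
have rowP' i : row i P' = v *m N' ^+ i by rewrite rowK.
have colQ j : col j Q = N ^+ (k - j) *m w.
  by apply/matrixP=> a b; rewrite !ord1 !mxE.
have vN0' i : (k < i)%N -> v *m N ^+ i = 0.
  by move=> ki; rewrite -(subnKC ki) exprD mulmxA vN0 mul0mx.
have PQE i j : (P *m Q) i j = (v *m N ^+ (i + (k - j)) *m w) 0 0.
  rewrite exprD mulmxA -mulmxA -rowP -colQ -col_mulmx -row_mul.
  by rewrite !mxE.
(* With the columns of Q in decreasing powers, P Q is upper triangular. *)
have uPQ : P *m Q \in unitmx.
  rewrite unitmxE -det_tr det_trig.
    rewrite unitfE prodf_seq_neq0; apply/allP=> i _ /=.
    rewrite mxE PQE subnKC; last by rewrite -ltnS.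
    by apply: contra_neq vNw => z; apply/matrixP=> a b; rewrite !ord1 z mxE.
  apply/is_trig_mxP=> i j ij; rewrite mxE PQE vN0' ?mul0mx ?mxE //.
  by have := ltn_ord i; have := ltn_ord j; lia.
pose R := invmx (P *m Q).
have PQR : P *m Q *m R = 1%:M by rewrite mulmxV.
have RPQ : R *m (P *m Q) = 1%:M by rewrite mulVmx.
have [J PN] : exists J, P *m N = J *m P.
  apply/submxP/row_subP=> i; rewrite row_mul rowP -mulmxA -[_ *m N]exprSr.
  case: (ltnP i k) => ik; last by rewrite vN0' ?sub0mx.
  by rewrite -(inordK (n' := k) (m := i.+1)) // -rowP row_sub.
have [J2 NQ] : exists J2, N *m Q = Q *m J2.
  have: ((N *m Q)^T <= Q^T)%MS.
    apply/row_subP=> j; rewrite -tr_col col_mulmx colQ mulmxA -[N *m _]exprS.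
    case: j => [[|j] jk] /=; first by rewrite subn0 Nw0 trmx0 sub0mx.
    rewrite subnSK //.
    have jk' : (j < k.+1)%N by exact: ltnW.
    rewrite -[X in (X <= _)%MS](_ : row (Ordinal jk') Q^T = _) ?row_sub //.
    by rewrite -tr_col colQ.
  by case/submxP=> J2 e; exists J2^T; rewrite -[LHS]trmxK e trmx_mul trmxK.
have JR : R *m J = J2 *m R.
  have e : J *m (P *m Q) = P *m Q *m J2 by rewrite mulmxA -PN -!mulmxA NQ.
  by rewrite -[LHS]mulmx1 -PQR mulmxA -(mulmxA R) e mulmxA RPQ mul1mx.
pose E1 := Q *m R *m P.
pose S := Q *m R *m P'.
have PE1 : P *m E1 = P by rewrite /E1 !mulmxA PQR mul1mx.
have PS : P *m S = P' by rewrite /S !mulmxA PQR mul1mx.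
have NE1 : N *m E1 = E1 *m N.
  by rewrite /E1 -!mulmxA PN !mulmxA NQ -!(mulmxA Q) -JR !mulmxA.
have gE1 : g * E1 = E1 * g.
  rewrite -[g](subrK 1) -/N mulrDl mulrDr mul1r mulr1.
  by congr (_ + _); exact: NE1.
(* For i > k both sides vanish, since h - 1 = - N h. *)
have vP i : v *m N ^+ i *m S = v *m N' ^+ i.
  case: (ltnP i k.+1) => ik.
    by rewrite -(rowP (Ordinal ik)) -row_mul PS rowP'.
  have -> : N' = N * - h by rewrite mulrN mulrBl gh mul1r opprB.
  have cNh : GRing.comm N (- h).
    by rewrite /GRing.comm /N mulrN mulNr mulrBl mulrBr gh hg mul1r mulr1.
  by rewrite exprMn_comm // -mulmxE mulmxA vN0' // !mul0mx.
have NS : N *m S = S *m N'.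
  have PNS : P *m N *m S = P' *m N'.
    apply/row_matrixP=> i; rewrite !row_mul rowP rowP'.
    by rewrite -(mulmxA v _ N) -(mulmxA v _ N') -[_ *m N]exprSr -[_ *m N']exprSr vP.
  have E1S : E1 *m S = S by rewrite /E1 -mulmxA PS.
  rewrite -{1}E1S mulmxA NE1 {1}/E1 -(mulmxA _ P) -(mulmxA _ _ S) PNS.
  by rewrite mulmxA.
have gS : g * S = S * h.
  rewrite -[g](subrK 1) -[h](subrK 1) -/N -/N' mulrDl mulrDr mul1r mulr1.
  by congr (_ + _); exact: NS.
have gSg : g * S * g = S by rewrite gS -mulrA hg mulr1.
have hS : h * S = S * g by rewrite -{1}gSg !mulrA hg mul1r.
have N'S1 : N' * S = S * N by rewrite mulrBl hS mulrBr mul1r mulr1.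
have N'S i : N' ^+ i *m S = S *m N ^+ i.
  elim: i => [|i IH]; first by rewrite !expr0 mulmx1 mul1mx.
  rewrite [N' ^+ _]exprSr [N ^+ _]exprSr -!mulmxE -mulmxA [N' *m S]N'S1.
  by rewrite -mulmxE mulmxA IH mulmxA.
(* S^2 commutes with N and fixes v, hence fixes every v N^i. *)
have row0P : row 0 P = v by rewrite rowP expr0 mulmx1.
have vE1 : v *m E1 = v by rewrite -row0P -row_mul PE1.
have vS : v *m S = v by rewrite -{1}row0P -row_mul PS rowP' expr0 mulmx1.
have E1N' i : N' ^+ i *m E1 = E1 *m N' ^+ i.
  have cE1h : GRing.comm E1 N'.
    rewrite /GRing.comm mulrBl mulrBr mul1r mulr1; congr (_ - _).
    by rewrite -[LHS]mul1r -hg -!mulrA (mulrA g) gE1 -!mulrA gh mulr1.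
  exact/esym/(commrX i cE1h).
exists E1, S; split=> //.
- by apply: contra_neq vNw => E10; rewrite -vE1 E10 mulmx0 !mul0mx.
- by rewrite -mulmxE {1}/E1 -mulmxA PE1.
- split; rewrite -mulmxE /E1.
    rewrite !mulmxA; congr (_ *m _ *m _).
    have EQ j : col j (E *m Q) = col j Q.
      by rewrite col_mulmx colQ mulmxA NXE -mulmxA Ew.
    apply/matrixP=> i j; have := congr1 (fun c : 'cV_m => c i 0) (EQ j).
    by rewrite !mxE.
  rewrite -mulmxA; congr (_ *m _); apply/row_matrixP=> i.
  by rewrite row_mul rowP -mulmxA -NXE mulmxA vE.
split=> //; rewrite -mulmxE.
- rewrite /S -mulmxA; congr (_ *m _); apply/row_matrixP=> i.
  by rewrite row_mul rowP' -mulmxA E1N' mulmxA vE1.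
- by rewrite /E1 -mulmxA PS.
- rewrite {1}/S /E1 -mulmxA; congr (_ *m _); apply/row_matrixP=> i.
  by rewrite row_mul rowP' rowP -mulmxA N'S mulmxA vS.
Qed.

(** Splitting off cyclic summands is done on projections E that commute with g,
    by induction on their rank, so that no change of dimension or of basis is
    needed. *)
Lemma unipotent_summand_inversion (F : fieldType) (m K : nat)
    (g h E : 'M[F]_m) :
  g * h = 1 -> h * g = 1 -> E * E = E -> g * E = E * g ->
  (g - 1) ^+ K * E = 0 ->
  exists S : 'M[F]_m, [/\ S * E = S, E * S = S, S * S = E & g * S * g = S].
Proof.
move=> gh hg.
elim/ltn_ind: {E}(\rank E) {-2}E (erefl (\rank E)) => r IH E rE EE gE NKE.
case: (eqVneq E 0) => [->|E0].
  by exists 0; split; rewrite ?mulr0 ?mul0r.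
have exN : exists i, (g - 1) ^+ i * E == 0 by exists K; apply/eqP.
have NE i : E * (g - 1) ^+ i = (g - 1) ^+ i * E.
  have cEN : GRing.comm E (g - 1).
    by rewrite /GRing.comm mulrBl mulrBr mul1r mulr1 gE.
  exact: (commrX i cEN).
case: (ex_minnP exN) => -[|k] /eqP NkE kmin.
  by rewrite expr0 mul1r in NkE; rewrite NkE eqxx in E0.
have {kmin} Nk0 : (g - 1) ^+ k * E != 0.
  by apply: contraTN (ltnSn k) => /kmin; rewrite -leqNgt.
have [i [j Nij]] := neq0_mx_entry Nk0.
have [|||||E1 [S1 [E10 EE1 gE1 [EE1l EE1r] [SE1 ES1 SS1 gS1]]]] :=
  @cyclic_summand_inversion F m k g h E (row i E) (col j E) gh hg gE.
- by rewrite -row_mul -[E *m E]/(E * E) EE.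
- by rewrite -col_mulmx -[E *m E]/(E * E) EE.
- by rewrite -row_mul -[E *m _]/(E * _) NE NkE row0.
- rewrite -col_mulmx -[_ *m E]/(_ * E) NkE.
  by apply/matrixP=> a b; rewrite !mxE.
- rewrite -row_mul -[E *m _]/(E * _) NE; apply: contra_neq Nij => Nij.
  transitivity ((row i ((g - 1) ^+ k * E) *m col j E) 0 0); last first.
    by rewrite Nij mxE.
  rewrite -[in LHS]EE mulrA !mxE.
  by apply: eq_bigr => a _; rewrite !mxE.
pose E2 := E - E1.
have E12 : E1 * E2 = 0 by rewrite mulrBr EE1r EE1 subrr.
have E21 : E2 * E1 = 0 by rewrite mulrBl EE1l EE1 subrr.
have EE2 : E * E2 = E2 by rewrite mulrBr EE1l EE.
have E2E : E2 * E = E2 by rewrite mulrBl EE1r EE.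
have E22 : E2 * E2 = E2 by rewrite {1}/E2 mulrBl EE2 E12 subr0.
have rlt : (\rank E2 < r)%N.
  rewrite -rE; have sE : (E2 <= E)%MS by rewrite -E2E submxMl.
  rewrite (ltn_leqif (mxrank_leqif_sup sE)).
  apply: contra_neqN E10 => /submxP[D ED].
  by rewrite -EE1l ED -mulmxE -mulmxA [E2 *m E1]E21 mulmx0.
have [|||S2 [SE2 ES2 SS2 gS2]] := IH _ rlt E2 erefl.
- exact: E22.
- by rewrite mulrBr mulrBl gE gE1.
- by rewrite -EE2 mulrA NKE mul0r.
have S12 : S1 * S2 = 0 by rewrite -SE1 -ES2 -mulrA (mulrA E1) E12 mul0r mulr0.
have S21 : S2 * S1 = 0 by rewrite -SE2 -ES1 -mulrA (mulrA E2) E21 mul0r mulr0.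
have ES : E = E1 + E2 by rewrite addrC subrK.
have S1E2 : S1 * E2 = 0 by rewrite -SE1 -mulrA E12 mulr0.
have S2E1 : S2 * E1 = 0 by rewrite -SE2 -mulrA E21 mulr0.
have E1S2 : E1 * S2 = 0 by rewrite -ES2 mulrA E12 mul0r.
have E2S1 : E2 * S1 = 0 by rewrite -ES1 mulrA E21 mul0r.
clearbody E2; exists (S1 + S2); split; rewrite 1?ES.
- by rewrite mulrDl !mulrDr SE1 SE2 S1E2 S2E1 addr0 add0r.
- by rewrite mulrDl !mulrDr ES1 ES2 E1S2 E2S1 addr0 add0r.
- by rewrite mulrDl !mulrDr SS1 SS2 S12 S21 addr0 add0r.
by rewrite mulrDr mulrDl gS1 gS2.
Qed.

Definition two_involutions (F : fieldType) (m : nat) (g : 'M[F]_m) : Prop :=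
  exists S1 S2, [/\ involution S1, involution S2 & g = S1 *m S2].

Lemma involutionP (F : fieldType) (m : nat) (S : 'M[F]_m) :
  S * S = 1 -> involution S.
Proof. by move=> SS; split=> //; case: (mulmx1_unit SS). Qed.

(** If d = -1 differs from 1, then y = (g - 1)^k satisfies y g = - y, hence
    y^2 = (-2)^k y, and y / (-2)^k is the projection to the eigenspace of -1.
    On that eigenspace g is its own inverse; on the complementary summand it is
    unipotent. *)
Lemma two_involutions_unipotent_sign (F : fieldType) (m k : nat)
    (g : 'M[F]_m) (d : F) :
  g \in unitmx -> d = 1 \/ d = -1 -> (g - 1) ^+ k * (g - d%:M) = 0 ->
  two_involutions g.
Proof.
move=> ug d1 gk; pose h := invmx g.
have gh : g * h = 1 by exact: mulmxV.
have hg : h * g = 1 by exact: mulVmx.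
suff [S [SS gS]] : exists S, S * S = 1 /\ g * S * g = S.
  (* g S g = S says that both S and g S are involutions. *)
  exists (g * S), S; split; try exact: involutionP.
    by apply: involutionP; rewrite mulrA gS SS.
  by rewrite -mulmxE -mulmxA [S *m S]SS mulmx1.
case: (eqVneq d 1) => [dE|dN1].
  have [||S [_ _ SS gS]] := @unipotent_summand_inversion F m k.+1 g h 1 gh hg (mulr1 1).
  - by rewrite mulr1 mul1r.
  - by rewrite mulr1 exprSr -[RHS]gk dE.
  by exists S.
have {d1} dE : d = -1 by case: d1 => // e; rewrite e eqxx in dN1.
have two0 : (-2 : F) != 0.
  rewrite oppr_eq0; apply: contra_neq dN1 => e.
  by apply/eqP; rewrite dE eq_sym -subr_eq0 opprK; apply/eqP; exact: e.
pose y := (g - 1) ^+ k; pose c := (-2 : F) ^+ k.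
have c0 : c != 0 by rewrite expf_neq0.
have yg : y * g = - y.
  move: gk; rewrite dE -/y mulrBr => /eqP; rewrite subr_eq0 => /eqP ->.
  by rewrite -mulmxE mul_mx_scalar scaleN1r.
have gy : g * y = y * g.
  have cg : GRing.comm g (g - 1) by rewrite /GRing.comm mulrBr mulrBl mulr1 mul1r.
  exact: (commrX k cg).
have yN i : y * (g - 1) ^+ i = (-2) ^+ i *: y.
  elim: i => [|i IH]; first by rewrite mulr1 scale1r.
  rewrite exprSr mulrA IH -mulmxE -scalemxAl mulmxBr [y *m g]yg mulmx1 exprSr.
  by rewrite -scalerA; congr (_ *: _); rewrite -opprD -mulr2n scaleNr scaler_nat.
pose E0 := c^-1 *: y.
have E00 : E0 * E0 = E0.
  rewrite /E0 -mulmxE -scalemxAl -scalemxAr [y *m y]yN -/c.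
  by rewrite [c^-1 *: (c *: y)]scalerA mulVf ?scale1r.
have gE0 : g * E0 = - E0.
  by rewrite /E0 -mulmxE -scalemxAr [g *m y]gy yg scalerN.
have E0g : E0 * g = - E0 by rewrite /E0 -mulmxE -scalemxAl [y *m g]yg scalerN.
pose E := 1 - E0.
have [|||S [SE ES SS gS]] := @unipotent_summand_inversion F m k g h E gh hg.
- by rewrite /E mulrBr mulr1 mulrBl mul1r E00 subrr subr0.
- by rewrite /E mulrBr mulrBl mulr1 mul1r gE0 E0g.
- rewrite -/y /E mulrBr mulr1 /E0 -mulmxE -scalemxAr [y *m y]yN -/c.
  by rewrite scalerA mulVf ?scale1r ?subrr.
have EE0 : E * E0 = 0 by rewrite /E mulrBl mul1r E00 subrr.
have E0E : E0 * E = 0 by rewrite /E mulrBr mulr1 E00 subrr.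
have SE0 : S * E0 = 0 by rewrite -SE -mulrA EE0 mulr0.
have E0S : E0 * S = 0 by rewrite -ES mulrA E0E mul0r.
clearbody E0; exists (S + E0); split.
  by rewrite mulrDl !mulrDr SS SE0 E0S E00 addr0 add0r subrK.
by rewrite mulrDr mulrDl gS gE0 mulNr E0g opprK.
Qed.

(** * Factoring a nonscalar matrix into unipotent matrices *)

Definition conjugate_mx (F : fieldType) (m : nat) (A B : 'M[F]_m) : Prop :=
  exists2 P, P \in unitmx & P *m A = B *m P.

Lemma conjugate_mx_trans (F : fieldType) (m : nat) (A B C : 'M[F]_m) :
  conjugate_mx A B -> conjugate_mx B C -> conjugate_mx A C.
Proof.
move=> [P uP PA] [Q uQ QB]; exists (Q *m P); first by rewrite unitmx_mul uQ uP.
by rewrite -mulmxA PA mulmxA QB mulmxA.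
Qed.

Lemma conjugate_mx_sym (F : fieldType) (m : nat) (A B : 'M[F]_m) :
  conjugate_mx A B -> conjugate_mx B A.
Proof.
move=> [P uP PA]; exists (invmx P); first by rewrite unitmx_inv.
by rewrite -[LHS](mulmxK uP) -(mulmxA _ B) -PA !mulmxA mulVmx // mul1mx.
Qed.

Lemma conjugate_mxE (F : fieldType) (m : nat) (A P Q : 'M[F]_m) :
  Q *m P = 1%:M -> conjugate_mx A (P *m A *m Q).
Proof.
move=> QP; exists P; first by case: (mulmx1_unit QP).
by rewrite -!mulmxA QP mulmx1.
Qed.

Lemma conjugate_mx_det (F : fieldType) (m : nat) (A B : 'M[F]_m) :
  conjugate_mx A B -> \det A = \det B.
Proof.
move=> [P]; rewrite unitmxE unitfE => dP /(congr1 determinant).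
by rewrite !det_mulmx mulrC => /(mulIf dP).
Qed.

(** A weak form of an LU decomposition whose diagonals are 1, ..., 1 and
    1, ..., 1, det A: annihilating polynomials replace the triangular shape, so
    that the conditions are invariant under conjugation. *)
Definition unipotent_factorable (F : fieldType) (m : nat) (A : 'M[F]_m) : Prop :=
  exists k (L R : 'M[F]_m),
    [/\ A = L *m R, (L - 1) ^+ k = 0 & (R - 1) ^+ k * (R - (\det A)%:M) = 0].

Lemma expr_conj (F : fieldType) (m k : nat) (P A : 'M[F]_m) :
  P \in unitmx -> (invmx P *m A *m P) ^+ k = invmx P *m A ^+ k *m P.
Proof.
move=> uP; elim: k => [|k IH]; first by rewrite !expr0 mulmx1 mulVmx.
rewrite [LHS]exprSr IH [A ^+ k.+1]exprSr -!mulmxE -!mulmxA (mulmxA P) mulmxV //.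
by rewrite mul1mx.
Qed.

Lemma unipotent_factorable_conjugate (F : fieldType) (m : nat) (A B : 'M[F]_m) :
  conjugate_mx A B -> unipotent_factorable B -> unipotent_factorable A.
Proof.
move=> AB; case: (AB) => P uP PA [k [L [R [BE Lk Rk]]]].
have cB (a : F) X : invmx P *m X *m P - a%:M = invmx P *m (X - a%:M) *m P.
  by rewrite mulmxBr mulmxBl mul_mx_scalar -scalemxAl mulVmx // scalemx1.
exists k, (invmx P *m L *m P), (invmx P *m R *m P); split.
- rewrite -!mulmxA (mulmxA P) mulmxV // mul1mx !mulmxA -(mulmxA _ L) -BE.
  by rewrite -mulmxA -PA mulKmx.
- by rewrite cB expr_conj // Lk mulmx0 mul0mx.
rewrite (conjugate_mx_det AB) !cB expr_conj // -mulmxE -!mulmxA (mulmxA P).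
by rewrite mulmxV // mul1mx (mulmxA (_ ^+ _)) [_ *m (R - _)]Rk mul0mx mulmx0.
Qed.

Lemma block_unipotent_upper (F : fieldType) (n k : nat) (r : 'rV[F]_n)
    (N : 'M[F]_n) :
  block_mx 0 r 0 N ^+ k.+1 = block_mx (0 : 'M_1) (r *m N ^+ k) 0 (N ^+ k.+1).
Proof.
elim: k => [|k IH]; first by rewrite !expr1 expr0 mulmx1.
rewrite exprSr IH -mulmxE mulmx_block !(mulmx0, mul0mx, add0r, addr0).
by rewrite -mulmxA !mulmxE -!exprSr.
Qed.

Lemma block_unipotent_lower (F : fieldType) (n k : nat) (c : 'cV[F]_n)
    (N : 'M[F]_n) :
  block_mx 0 0 c N ^+ k.+1 = block_mx (0 : 'M_1) 0 (N ^+ k *m c) (N ^+ k.+1).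
Proof.
elim: k => [|k IH]; first by rewrite !expr1 expr0 mul1mx.
rewrite exprS IH -mulmxE mulmx_block !(mulmx0, mul0mx, add0r, addr0).
by rewrite mulmxA !mulmxE -!exprS.
Qed.

Lemma det_block_schur (F : fieldType) (n : nat) (r : 'rV[F]_n) (c : 'cV[F]_n)
    (D : 'M[F]_n) :
  \det (block_mx (1%:M : 'M_1) r c D) = \det (D - c *m r).
Proof.
have -> : block_mx (1%:M : 'M_1) r c D =
    block_mx 1%:M 0 c 1%:M *m block_mx 1%:M r 0 (D - c *m r).
  by rewrite mulmx_block !(mulmx0, mul0mx, mulmx1, mul1mx, addr0, add0r) addrC subrK.
by rewrite det_mulmx det_lblock det_ublock !det1 !mul1r.
Qed.

(** One step of the LU decomposition: a factorization L R of the Schur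
    complement extends to the factors with blocks 1, 0, c, L and 1, r, 0, R. *)
Lemma unipotent_factorable_schur (F : fieldType) (n : nat) (r : 'rV[F]_n)
    (c : 'cV[F]_n) (D : 'M[F]_n) :
  unipotent_factorable (D - c *m r) ->
  unipotent_factorable (block_mx (1%:M : 'M_1) r c D).
Proof.
move=> [k [L [R [DE Lk Rk]]]].
have B1 (a : F) (u : 'rV[F]_n) (v : 'cV[F]_n) X :
    block_mx 1%:M u v X - a%:M = block_mx (1%:M - a%:M) u v (X - a%:M).
  by rewrite scalar_mx_block opp_block_mx add_block_mx !oppr0 !addr0.
exists k.+1, (block_mx 1%:M 0 c L), (block_mx 1%:M r 0 R); split.
- rewrite mulmx_block !(mulmx0, mul0mx, mulmx1, mul1mx, addr0, add0r) -DE.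
  by rewrite addrC subrK.
- by rewrite B1 subrr block_unipotent_lower exprS Lk mulr0 mul0mx block_mx0.
rewrite det_block_schur !B1 subrr block_unipotent_upper -mulmxE mulmx_block.
have {}Rk : (R - 1%:M) ^+ k *m (R - (\det (D - c *m r))%:M) = 0 := Rk.
rewrite !(mulmx0, mul0mx, add0r, addr0) -(mulmxA r) Rk mulmx0.
by rewrite exprS -mulmxE -mulmxA Rk mulmx0 block_mx0.
Qed.

Lemma mul_delta_mxE (F : fieldType) (m n : nat) (A : 'M[F]_(m, n)) (i : 'I_m)
    (j a : 'I_m) (b : 'I_n) :
  (delta_mx j i *m A) a b = (a == j)%:R * A i b.
Proof.
rewrite mxE (bigD1 i) //= mxE eqxx andbT big1 ?addr0 // => k ki.
by rewrite mxE (negPf ki) andbF mul0r.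
Qed.

Lemma mulmx_deltaE (F : fieldType) (m n : nat) (A : 'M[F]_(m, n)) (i j : 'I_n)
    (a : 'I_m) (b : 'I_n) :
  (A *m delta_mx j i) a b = A a j * (b == i)%:R.
Proof.
rewrite mxE (bigD1 j) //= mxE eqxx /= big1 ?addr0 // => k kj.
by rewrite mxE (negPf kj) mulr0.
Qed.

Lemma conjugate_transvection (F : fieldType) (n : nat) (A : 'M[F]_n)
    (i j : 'I_n) (x : F) : i != j ->
  conjugate_mx A (\matrix_(a, b)
    (A a b + x * (a == j)%:R * A i b
     - x * (A a j + x * (a == j)%:R * A i j) * (b == i)%:R)).
Proof.
move=> ij; pose E := x *: delta_mx j i : 'M[F]_n.
have EE : E *m E = 0.
  by rewrite -scalemxAl -scalemxAr mul_delta_mx_0 // !scaler0.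
set B := \matrix_(a, b) _.
have -> : B = (1%:M + E) *m A *m (1%:M - E).
  pose Y := delta_mx j i *m A; pose Z := A *m delta_mx j i.
  pose W := Y *m delta_mx j i.
  have YE a b : Y a b = (a == j)%:R * A i b by exact: mul_delta_mxE.
  have ZE a b : Z a b = A a j * (b == i)%:R by exact: mulmx_deltaE.
  have WE a b : W a b = Y a j * (b == i)%:R by exact: mulmx_deltaE.
  rewrite mulmxDl mul1mx mulmxBr mulmx1 -scalemxAl -!scalemxAr mulmxDl -scalemxAl.
  rewrite -/Y -/W -/Z; clearbody Y Z W.
  by apply/matrixP=> a b; rewrite !mxE !(YE, ZE, WE); ring.
apply: conjugate_mxE.
by rewrite mulmxDr mulmxBl !mulmx1 mulmxBl mul1mx EE subr0 subrK.
Qed.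

Lemma conjugate_perm (F : fieldType) (n : nat) (A : 'M[F]_n) (s : 'S_n) :
  conjugate_mx A (\matrix_(a, b) A (s a) (s b)).
Proof.
have -> : \matrix_(a, b) A (s a) (s b) = perm_mx s *m A *m perm_mx (s^-1)%g.
  by rewrite -row_permE -col_permE; apply/matrixP=> a b; rewrite !mxE.
by apply: conjugate_mxE; rewrite -perm_mxM fingroup.mulVg perm_mx1.
Qed.

(** A diagonal matrix with two different diagonal entries acquires a nonzero
    off-diagonal entry by conjugation with a transvection. *)
Lemma nonscalar_offdiag (F : fieldType) (n : nat) (A : 'M[F]_n) :
  ~~ is_scalar_mx A ->
  exists (B : 'M[F]_n) (i j : 'I_n), [/\ conjugate_mx A B, i != j & B i j != 0].
Proof.
move=> nsA.
case: (boolP [exists i, [exists j, (i != j) && (A i j != 0)]]) => [|H].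
  move=> /existsP[i /existsP[j /andP[ij Aij]]]; exists A, i, j; split=> //.
  by exists 1%:M; rewrite ?unitmx1 // mul1mx mulmx1.
have A0 i j : i != j -> A i j = 0.
  move=> ij; apply/eqP; apply: contraNT H => Aij.
  by apply/existsP; exists i; apply/existsP; exists j; rewrite ij.
case: (boolP [exists i, [exists j, A i i != A j j]]) => [|{}H].
  move=> /existsP[i /existsP[j Aij]].
  have ij : i != j by apply: contra_neq Aij => ->.
  have Aji : A j i = 0 by rewrite A0 // eq_sym.
  eexists; exists j, i.
  split; [exact: (conjugate_transvection A 1 ij) | by rewrite eq_sym |].
  rewrite mxE !eqxx !(mul1r, mulr1) (A0 i j) // Aji.
  by rewrite add0r addr0 subr_eq0.
case/negP: nsA; case: n A A0 H => [|n] A A0 H.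
  by rewrite [A]flatmx0; apply/is_scalar_mxP; exists 0; apply/matrixP=> -[].
apply/is_scalar_mxP; exists (A 0 0); apply/matrixP=> i j; rewrite mxE.
case: (eqVneq i j) => [->|ij]; last exact: A0.
apply/eqP; apply: contraNT H => Aij.
by apply/existsP; exists j; apply/existsP; exists 0.
Qed.

(** Conjugating by 1 + x E_ji subtracts x B_ij from the entry B_ii and keeps
    B_ij, so B_ij <> 0 allows the value 1 at (i, i). *)
Lemma nonscalar_block (F : fieldType) (n : nat) (A : 'M[F]_n.+1) :
  ~~ is_scalar_mx A ->
  exists (r : 'rV[F]_n) c D,
    r != 0 /\ conjugate_mx A (block_mx (1%:M : 'M_1) r c D).
Proof.
move=> /nonscalar_offdiag[B [i [j [AB ij Bij]]]].
pose x := (B i i - 1) / B i j.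
pose s : 'S_n.+1 := tperm 0 i.
have := conjugate_mx_trans (conjugate_mx_trans AB (conjugate_transvection B x ij))
  (conjugate_perm _ s).
set C : 'M_(1 + n) := \matrix_(_, _) _ => AC.
have C00 : C 0 0 = 1.
  rewrite !mxE /s tpermL eqxx (negPf ij) !(mulr0, mul0r, mulr1, addr0).
  by rewrite /x divfK // opprB addrC subrK.
have C0j : C 0 (s j) = B i j.
  rewrite !mxE /s tpermL tpermK (negPf ij) eq_sym (negPf ij).
  by rewrite !(mulr0, mul0r, addr0) subr0.
exists (ursubmx C), (dlsubmx C), (drsubmx C); split.
  have sj0 : s j != 0 by rewrite -(tpermR 0 i) (inj_eq perm_inj) eq_sym.
  apply: contra_neq Bij; rewrite -C0j.
  case: (unliftP 0 (s j)) sj0 => [k ->|->]; last by rewrite eqxx.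
  move=> _ /matrixP/(_ 0 k); rewrite !mxE.
  rewrite (_ : rshift 1 k = lift 0 k); last exact/val_inj.
  by rewrite (_ : lshift n 0 = 0) //; exact/val_inj.
have <- : C = block_mx (1%:M : 'M_1) (ursubmx C) (dlsubmx C) (drsubmx C).
  rewrite -[LHS]submxK; congr block_mx.
  apply/matrixP=> a b; rewrite !ord1 [LHS]mxE [RHS]mxE eqxx -C00 mxE.
  by congr (C _ _); exact/val_inj.
exact: AC.
Qed.

Lemma conjugate_block_shear (F : fieldType) (n : nat) (r : 'rV[F]_n)
    (c x : 'cV[F]_n) (D : 'M[F]_n) :
  r *m x = 0 ->
  conjugate_mx (block_mx (1%:M : 'M_1) r c D)
               (block_mx 1%:M r (x + c - D *m x) (x *m r + D)).
Proof.
move=> rx.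
have -> : block_mx (1%:M : 'M_1) r (x + c - D *m x) (x *m r + D) =
    block_mx 1%:M 0 x 1%:M *m block_mx 1%:M r c D *m block_mx 1%:M 0 (- x) 1%:M.
  rewrite !mulmx_block !(mulmx0, mul0mx, mulmx1, mul1mx, addr0, add0r).
  by rewrite !mulmxN rx subr0 mulmxDl -(mulmxA x) rx mulmx0 add0r.
apply: conjugate_mxE.
rewrite mulmx_block !(mulmx0, mul0mx, mulmx1, mul1mx, addr0, add0r) addNr.
by rewrite -scalar_mx_block.
Qed.

(** If the Schur complement is a scalar s, a further conjugation by the block
    matrix 1, 0, x, 1 with r x = 0 and x <> 0 turns it into s (1 + x r), which
    differs from a scalar by a matrix of rank one.  Such an x exists unless r
    has only one column. *)
Lemma nonscalar_schur (F : fieldType) (n : nat) (A : 'M[F]_n.+2) :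
  A \in unitmx -> ~~ is_scalar_mx A ->
  exists (r : 'rV[F]_n.+1) c D,
    conjugate_mx A (block_mx (1%:M : 'M_1) r c D)
    /\ (n = 0 \/ ~~ is_scalar_mx (D - c *m r)).
Proof.
move=> uA /nonscalar_block[r [c [D [r0 AB]]]].
case: (boolP (is_scalar_mx (D - c *m r))) => [/is_scalar_mxP[s Ds]|nsD]; last first.
  by exists r, c, D; split=> //; right.
case: n => [|n] in A uA r c D r0 AB Ds *.
  by exists r, c, D; split=> //; left.
have s0 : s != 0.
  move: uA; rewrite unitmxE unitfE (conjugate_mx_det AB).
  rewrite det_block_schur Ds det_scalar.
  by apply: contra_neq => ->; rewrite expr0n.
have [x x0 rx] : exists2 x : 'cV[F]_n.+2, x != 0 & r *m x = 0.
  have : cokermx r != 0.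
    by rewrite -mxrank_eq0 mxrank_coker; have := rank_leq_row r; lia.
  move=> /neq0_mx_entry[i [j ij]]; exists (col j (cokermx r)).
    by apply: contra_neq ij => /matrixP/(_ i 0); rewrite !mxE.
  by rewrite -col_mulmx mulmx_coker; apply/matrixP=> a b; rewrite !mxE.
exists r, (x + c - D *m x), (x *m r + D); split.
  exact: conjugate_mx_trans AB (conjugate_block_shear _ _ rx).
right; apply/is_scalar_mxP=> -[b].
have -> : x *m r + D - (x + c - D *m x) *m r = s *: (1%:M + x *m r).
  have DE : D = s%:M + c *m r by rewrite -Ds subrK.
  rewrite mulmxBl mulmxDl DE !mulmxDl -(mulmxA c) rx mulmx0 ?mul0mx.
  rewrite addr0 mul_scalar_mx.
  rewrite scalerDr scalemx1 scalemxAl.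
  by apply/matrixP=> i j; rewrite !mxE; ring.
(* Applying s (1 + x r) to x shows that the scalar could only be s itself. *)
move=> e; have := congr1 (mulmx^~ x) e.
rewrite -scalemxAl mulmxDl -mulmxA rx mulmx0 addr0 mul1mx mul_scalar_mx.
move=> /eqP; rewrite -subr_eq0 -scalerBl scaler_eq0 (negPf x0) orbF subr_eq0.
move=> /eqP sb.
rewrite -sb -[s%:M]scalemx1 in e.
have xr : x *m r = 0.
  by apply: (addrI 1%:M); rewrite addr0; apply: (scalerI s0); exact: e.
have [i [j xi]] := neq0_mx_entry x0; have [i' [k rk]] := neq0_mx_entry r0.
have := congr1 (fun B : 'M_n.+2 => B i k) xr.
rewrite !mxE big_ord1 => /eqP; rewrite mulf_eq0; rewrite !ord1 in xi rk.
by rewrite (negPf xi) (negPf rk).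
Qed.

Lemma unipotent_factorization (F : fieldType) (n : nat) (A : 'M[F]_n) :
  A \in unitmx -> ~~ is_scalar_mx A -> unipotent_factorable A.
Proof.
elim: n A => [|[|n] IH] A uA nsA.
- by case/is_scalar_mxP: nsA; exists 0; apply/matrixP=> -[].
- by case/is_scalar_mxP: nsA; exists (A 0 0); exact: mx11_scalar.
have [r [c [D [AB nsD]]]] := nonscalar_schur uA nsA.
apply: (unipotent_factorable_conjugate AB); apply: unipotent_factorable_schur.
case: nsD => [n0|nsD].
  subst n; set B := _ - _; exists 1, 1%:M, B; split.
  - by rewrite mul1mx.
  - by rewrite subrr expr1.
  by rewrite expr1 {2}[B]mx11_scalar det_mx11 subrr mulr0.
apply: IH nsD; move: uA; rewrite !unitmxE (conjugate_mx_det AB).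
by rewrite det_block_schur.
Qed.

(** * From a factorization of A to the block matrix *)

Lemma two_involutions_conjugate (F : fieldType) (m : nat) (A B : 'M[F]_m) :
  conjugate_mx A B -> two_involutions B -> two_involutions A.
Proof.
move=> [P uP PA] [S1 [S2 [[_ S11] [_ S22] BE]]].
have VPP (X Y : 'M[F]_m) : invmx P *m X *m P *m (invmx P *m Y *m P)
    = invmx P *m (X *m Y) *m P.
  by rewrite -!mulmxA (mulmxA P) mulmxV // mul1mx.
exists (invmx P *m S1 *m P), (invmx P *m S2 *m P); split.
- by apply: involutionP; rewrite -mulmxE VPP S11 mulmx1 mulVmx.
- by apply: involutionP; rewrite -mulmxE VPP S22 mulmx1 mulVmx.
by rewrite VPP -BE -mulmxA -PA mulKmx.
Qed.

Lemma U2_shift (F : fieldType) (m : nat) (N : 'M[F]_m) :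
  N *m N = 0 -> U2_matrix (1%:M + N).
Proof.
move=> NN; split; last by rewrite addrC addKr.
have e : (1%:M + N) *m (1%:M - N) = 1%:M.
  by rewrite mulmxDl !mulmxBr NN !mulmx1 mul1mx subr0 subrK.
by case: (mulmx1_unit e).
Qed.

Lemma prod_of_conjugate (F : fieldType) (m : nat) (M M' N : 'M[F]_m) :
  conjugate_mx M M' -> N *m N = 0 -> two_involutions (M' *m (1%:M + N)) ->
  prod_two_involutions_one_U2 M.
Proof.
move=> [P uP PM] NN tI.
have : two_involutions (M *m (1%:M + invmx P *m N *m P)).
  apply: two_involutions_conjugate tI; exists P => //.
  rewrite mulmxA PM -!mulmxA; congr (M' *m _).
  by rewrite mulmxDr mulmxDl mulmx1 mul1mx !mulmxA mulmxV // mul1mx.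
set V := invmx P *m N *m P => -[S1 [S2 [I1 I2 e]]].
have VV : V *m V = 0.
  by rewrite /V -!mulmxA (mulmxA P) mulmxV // mul1mx (mulmxA N) NN mul0mx mulmx0.
exists S1, S2, (1%:M - V); split=> //.
  by apply: U2_shift; rewrite mulmxN mulNmx VV !oppr0.
have V1 : (1%:M + V) *m (1%:M - V) = 1%:M.
  by rewrite mulmxDl !mulmxBr VV !mulmx1 mul1mx subr0 subrK.
by apply: Or31; rewrite -e -mulmxA V1 mulmx1.
Qed.

Lemma block_upper_expr (F : fieldType) (n1 n2 k : nat) (X : 'M[F]_n1) B
    (W : 'M[F]_n2) :
  exists C, block_mx X B 0 W ^+ k = block_mx (X ^+ k) C 0 (W ^+ k).
Proof.
elim: k => [|k [C IH]].
  by exists 0; rewrite !expr0 -scalar_mx_block.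
exists (X *m C + B *m W ^+ k); rewrite !exprS IH -mulmxE mulmx_block.
by rewrite !(mulmx0, mul0mx, add0r, addr0).
Qed.

(** Put D = A - 1.  For any G, the matrix M' = 1 + (1; 1) D (1 - G, G) is
    conjugate to A (+) 1.  The choice of G with D G = W - 1, followed by adding
    (1 - X) times the second block column to the first, makes M' block upper
    triangular with diagonal blocks X and W. *)
Lemma prod_of_factorization (F : fieldType) (n i j : nat) (A W X G : 'M[F]_n)
    (d : F) :
  A \in unitmx -> d = 1 \/ d = -1 -> A = W *m X -> W - 1%:M = (A - 1%:M) *m G ->
  (W - 1) ^+ i = 0 -> (X - 1) ^+ j * (X - d%:M) = 0 ->
  prod_two_involutions_one_U2 (block_mx A 0 0 (1%:M : 'M_n)).
Proof.
move=> uA d1 AE WG Wi Xj.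
pose D := A - 1%:M; pose H := 1%:M - G.
have AD : A = 1%:M + D by rewrite addrC subrK.
have DG : D *m G = W - 1%:M by [].
have DH : D *m H = A - W.
  by rewrite mulmxBr mulmx1 DG /D opprB addrA subrK.
pose M' := block_mx (1%:M + D *m H) (D *m G) (D *m H) (1%:M + D *m G).
pose N : 'M[F]_(n + n) := block_mx 0 0 (1%:M - X) 0.
have NN : N *m N = 0 by rewrite mulmx_block !(mulmx0, mul0mx, addr0) block_mx0.
apply: (@prod_of_conjugate F _ _ M' N) => //.
  apply: conjugate_mx_sym; exists (block_mx H G (- 1%:M) 1%:M).
    have HG : H *m G = G *m H by rewrite mulmxBr mulmxBl mulmx1 mul1mx.
    have e : block_mx H G (- 1%:M) 1%:M *m block_mx 1%:M (- G) 1%:M H = 1%:M.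
      rewrite mulmx_block !(mulmx1, mul1mx, mulNmx, mulmxN) HG opprK subrK.
      by rewrite !addNr addrC subrK -scalar_mx_block.
    by case: (mulmx1_unit e).
  rewrite !mulmx_block !(mulmx0, mul0mx, addr0, add0r, mul1mx, mulNmx).
  have HG1 : H + G = 1%:M by rewrite subrK.
  congr block_mx.
  - by rewrite mulmxDr mulmx1 -addrA -mulmxDl HG1 mul1mx [in RHS]AD mulmxDl mul1mx.
  - by rewrite mulmxDr mulmx1 addrCA -mulmxDl HG1 mul1mx [in RHS]AD mulmxDl mul1mx.
  - by rewrite opprD subrK.
  by rewrite addrCA addNr addr0.
have M'U : M' *m (1%:M + N) = block_mx X (W - 1%:M) 0 W.
  rewrite mulmxDr mulmx1 mulmx_block !(mulmx0, addr0, add0r) add_block_mx !addr0.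
  rewrite DG DH [1%:M + (W - _)]addrC subrK !mulmxBr !mulmxBl !mulmx1 !mul1mx -AE.
  by congr block_mx; apply/matrixP=> a b; rewrite !mxE; ring.
rewrite M'U.
have [uW uX] : W \in unitmx /\ X \in unitmx.
  by move: uA; rewrite AE unitmx_mul => /andP.
apply: (@two_involutions_unipotent_sign F _ (j + i) _ d) => //.
  by rewrite unitmxE det_ublock unitrM -!unitmxE uX uW.
set g := block_mx _ _ _ _.
have BE (a : F) : g - a%:M = block_mx (X - a%:M) (W - 1%:M) 0 (W - a%:M).
  by rewrite scalar_mx_block opp_block_mx add_block_mx !oppr0 !addr0.
have [C CE] := block_upper_expr j (X - 1%:M) (W - 1%:M) (W - 1%:M).
have [C' CE'] := block_upper_expr i (X - 1%:M) (W - 1%:M) (W - 1%:M).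
have cg : GRing.comm ((g - 1) ^+ j * (g - d%:M)) ((g - 1) ^+ i).
  apply: commrX; apply/commr_sym; apply: commrM; first exact/commrX/commr_refl.
  apply: commrB; last by rewrite /GRing.comm -!mulmxE scalar_mxC.
  by apply/commr_sym/commrB; [exact: commr_refl | exact: commr1].
have {}Xj : (X - 1%:M) ^+ j *m (X - d%:M) = 0 := Xj.
have {}Wi : (W - 1%:M) ^+ i = 0 := Wi.
(* (g - 1)^j (g - d) has zero first block column, and (g - 1)^i has zero
   second block row. *)
rewrite addnC exprD -mulrA -cg !BE CE CE' -!mulmxE !mulmx_block.
by rewrite Wi Xj !(mul0mx, mulmx0, addr0, add0r) block_mx0.
Qed.

Lemma det_add1_mulmxC (F : fieldType) (n s : nat) (p : 'M[F]_(n, s))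
    (q : 'M[F]_(s, n)) :
  \det (1%:M + p *m q) = \det (1%:M + q *m p).
Proof.
have : block_mx 1%:M (- p) 0 1%:M *m block_mx (1%:M + p *m q) 0 q 1%:M =
       block_mx 1%:M 0 q 1%:M *m block_mx 1%:M (- p) 0 (1%:M + q *m p).
  rewrite !mulmx_block !(mulmx0, mul0mx, addr0, add0r, mulmx1, mul1mx).
  rewrite mulNmx mulmxN addrK; congr block_mx.
  by rewrite addrCA addNr addr0.
move=> /(congr1 determinant).
by rewrite !det_mulmx !det_lblock !det_ublock !det1 !(mul1r, mulr1).
Qed.

(** A factorization of 1 + q p lifts to 1 + p q: W' becomes 1 + p u with
    u = (W' - 1) p', and the second factor is then 1 + p z with z p = X' - 1.
    Polynomial identities for u p and z p carry over to p u and p z at the cost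
    of one more power. *)
Lemma prod_of_factorable_compression (F : fieldType) (n s : nat)
    (p : 'M[F]_(n, s)) (q : 'M[F]_(s, n)) p' q' :
  let A := 1%:M + p *m q in
  A \in unitmx -> \det A = 1 \/ \det A = -1 ->
  p' *m p = 1%:M -> q *m q' = 1%:M ->
  unipotent_factorable (1%:M + q *m p) ->
  prod_two_involutions_one_U2 (block_mx A 0 0 (1%:M : 'M_n)).
Proof.
move=> A uA dA pp qq [k [W' [X' [AE Wk Xk]]]].
rewrite -det_add1_mulmxC in Xk.
have push (Y : 'M[F]_s) (u : 'M[F]_(s, n)) i : u *m p = Y ->
    (p *m u) ^+ i.+1 = p *m Y ^+ i *m u.
  move=> uE; elim: i => [|i IH]; first by rewrite expr1 expr0 mulmx1.
  by rewrite exprSr IH [Y ^+ i.+1]exprSr -!mulmxE -!mulmxA (mulmxA u) uE.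
have [uW' uX'] : W' \in unitmx /\ X' \in unitmx.
  have : 1%:M + q *m p \in unitmx by rewrite unitmxE -det_add1_mulmxC -unitmxE.
  by rewrite AE unitmx_mul => /andP.
pose V' := invmx W'.
have V'W' : V' *m W' = 1%:M by exact: mulVmx.
have W'V' : W' *m V' = 1%:M by exact: mulmxV.
pose u := (W' - 1%:M) *m p'.
pose z := V' *m (p' + q) - p'.
have up : u *m p = W' - 1%:M by rewrite /u -mulmxA pp mulmx1.
have zp : z *m p = X' - 1%:M.
  rewrite mulmxBl pp -mulmxA mulmxDl pp AE mulmxA V'W' mul1mx //.
have add1K (Y : 'M[F]_n) : 1%:M + Y - 1%:M = Y by rewrite addrC addKr.
apply: (@prod_of_factorization F n k.+1 k.+1 A (1%:M + p *m u) (1%:M + p *m z)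
          (q' *m u) (\det A)) => //.
- rewrite mulmxDl mul1mx mulmxDr mulmx1 -(mulmxA p u) (mulmxA u p) up.
  rewrite -addrA -!mulmxDr; congr (_ + _ *m _).
  have Wz : W' *m z = p' + q - W' *m p' by rewrite mulmxBr mulmxA W'V' mul1mx.
  rewrite mulmxBl mul1mx mulmxDr Wz [W' *m p' + _]addrC subrK opprD.
  rewrite [p' + q + _]addrACA.
  by rewrite addrN add0r [RHS]addrC subrK.
- by rewrite /A !add1K -mulmxA (mulmxA q) qq mul1mx.
- rewrite add1K (push _ _ _ up).
  by rewrite Wk mulmx0 mul0mx.
have {}Xk : (X' - 1%:M) ^+ k *m (X' - (\det A)%:M) = 0 := Xk.
rewrite add1K [1%:M + _]addrC (push _ _ _ zp) -mulmxE -mulmxA.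
have -> : z *m (p *m z + 1%:M - (\det A)%:M) = (X' - (\det A)%:M) *m z.
  rewrite mulmxBr mulmxDr mulmxA zp mulmxBl mulmx1 mul1mx subrK.
  by rewrite mul_mx_scalar mulmxBl mul_scalar_mx.
by rewrite mulmxA -(mulmxA p) Xk mulmx0 mul0mx.
Qed.

(** * The scalar case *)

(** The vector e_0 G^j for the cyclic shift G of m + 1 basis vectors with
    G^(m + 1) = t.  Indexing by all natural numbers j makes the wrap-around
    with its sign a matter of arithmetic on indices. *)
Definition cyclic_row (F : fieldType) (m : nat) (t : F) (j : nat) : 'rV[F]_m.+1 :=
  t ^+ (j %/ m.+1) *: delta_mx 0 (inord (j %% m.+1)).

Lemma cyclic_row_ord (F : fieldType) (m : nat) (t : F) (i : 'I_m.+1) :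
  cyclic_row m t i = delta_mx 0 i.
Proof.
by rewrite /cyclic_row divn_small // modn_small // inord_val scale1r.
Qed.

Lemma cyclic_rowD (F : fieldType) (m : nat) (t : F) (j : nat) :
  cyclic_row m t (j + m.+1) = t *: cyclic_row m t j.
Proof. by rewrite /cyclic_row divnDr // divnn addn1 exprS modnDr scalerA. Qed.

Lemma cyclic_row_period (F : fieldType) (m : nat) (t : F) (j j' q : nat) :
  t * t = 1 -> j' = (j + q * (2 * m.+1))%N -> cyclic_row m t j' = cyclic_row m t j.
Proof.
move=> tt ->; elim: q => [|q IH]; first by rewrite mul0n addn0.
have -> : (j + q.+1 * (2 * m.+1) = j + q * (2 * m.+1) + m.+1 + m.+1)%N by lia.
by rewrite !cyclic_rowD scalerA tt scale1r.
Qed.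

Lemma cyclic_row_mul (F : fieldType) (m p : nat) (t : F) (f : nat -> 'rV[F]_p)
    (j : nat) :
  (forall i, f (i + m.+1)%N = t *: f i) ->
  cyclic_row m t j *m (\matrix_(i < m.+1) f i) = f j.
Proof.
move=> fD; rewrite -scalemxAl -rowE rowK inordK ?ltn_mod //.
rewrite [in RHS](divn_eq j m.+1) addnC; elim: (j %/ _)%N => [|q IH].
  by rewrite scale1r mul0n addn0.
by rewrite exprS -scalerA IH -fD; congr f; lia.
Qed.

Lemma cyclic_row_ext (F : fieldType) (m p : nat) (t : F) (A B : 'M[F]_(m.+1, p)) :
  (forall j, cyclic_row m t j *m A = cyclic_row m t j *m B) -> A = B.
Proof.
by move=> AB; apply/row_matrixP=> i; rewrite !rowE -(cyclic_row_ord t) AB.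
Qed.

Definition cyclic_shift (F : fieldType) (m : nat) (t : F) : 'M[F]_m.+1 :=
  \matrix_(i < m.+1) cyclic_row m t i.+1.

Lemma mul_cyclic_shift (F : fieldType) (m : nat) (t : F) (j : nat) :
  cyclic_row m t j *m cyclic_shift m t = cyclic_row m t j.+1.
Proof.
rewrite (cyclic_row_mul (f := fun i => cyclic_row m t i.+1)) // => i.
by rewrite -addSn cyclic_rowD.
Qed.

(** The shift e_j |-> e_(j+1) is the composite of the reflections e_j |-> e_(-j)
    and e_j |-> e_(1-j).  The indices matter modulo 2 (m + 1), so that
    r = 2 m + 1 plays the role of -1. *)
Lemma two_involutions_cyclic_shift (F : fieldType) (m : nat) (t : F) :
  t * t = 1 -> two_involutions (cyclic_shift m t).
Proof.
move=> tt; pose E := cyclic_row m t; pose r := (2 * m).+1.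
pose f a j : 'rV[F]_m.+1 := E (r * j + a).
have fD a i : f a (i + m.+1)%N = t *: f a i.
  rewrite /f -cyclic_rowD; apply: (cyclic_row_period (q := m) tt).
  by nia.
pose S a : 'M[F]_m.+1 := \matrix_(i < m.+1) f a i.
have SE a j : E j *m S a = E (r * j + a) by rewrite cyclic_row_mul.
have SS a : S a * S a = 1.
  apply: (@cyclic_row_ext F m m.+1 t) => j; rewrite mulmx1 -mulmxE mulmxA !SE.
  apply: (cyclic_row_period (q := (2 * m * j + a)) tt); nia.
exists (S 0), (S 1); split; try exact/involutionP/SS.
apply: (@cyclic_row_ext F m m.+1 t) => j; rewrite mul_cyclic_shift mulmxA !SE.
apply/esym/(cyclic_row_period (q := (2 * m * j)) tt); nia.
Qed.

(** Let n = s + 1.  In F[x] / (x^(2n) + b^n), where G is multiplication by x,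
    the rows of W are w_i = x^i + (b / x)^i, i < n, with 1 instead of 2 for w_0.
    Multiplication by x + b / x sends w_0 to w_1, w_1 to w_2 + 2 b w_0 and w_i to
    w_(i+1) + b w_(i-1) for i > 1, and w_n = 0.  So the span of the w_i is stable
    under x + b / x, which acts on it by a matrix T.  In the basis formed by the
    w_i and the x w_i, the shift G becomes the block companion matrix C of
    z^2 - T z + b. *)
Lemma prod_scalar_block (F : fieldType) (s : nat) (b : F) :
  b != 1 -> b ^+ s.+1 = 1 \/ b ^+ s.+1 = -1 ->
  prod_two_involutions_one_U2 (block_mx (b%:M : 'M[F]_s.+1) 0 0 (1%:M : 'M[F]_s.+1)).
Proof.
move=> b1 bs; pose t := - b ^+ s.+1.
have tt : t * t = 1 by rewrite mulrNN; case: bs => ->; rewrite ?mulrNN mulr1.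
pose m := (s + s.+1)%N; pose r := (2 * m).+1.
pose E := cyclic_row m t; pose G := cyclic_shift m t.
have EG j : E j *m G = E j.+1 by exact: mul_cyclic_shift.
have Ep j j' q : j' = (j + q * (2 * m.+1))%N -> E j' = E j.
  exact: cyclic_row_period.
pose w i := if i == 0 then E 0 else E i + b ^+ i *: E (r * i)%N.
pose W := \matrix_(i < s.+1) w i.
pose WG := W *m G.
have rowWG i : row i WG = w i *m G by rewrite row_mul rowK.
have wG i : i != 0 -> w i *m G = E i.+1 + b ^+ i *: E (r * i).+1.
  by rewrite /w => /negPf ->; rewrite mulmxDl -scalemxAl !EG.
(* The bound includes i = s + 1, the dimension of b, where w_i = 0. *)
have sWG i : (i <= s.+1)%N -> (w i *m G <= WG)%MS.
  rewrite leq_eqVlt => /predU1P[->|lt_is].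
    have -> : w s.+1 *m G = 0; last exact: sub0mx.
    rewrite wG // (Ep (s.+2 + m.+1)%N (r * s.+1).+1 s); last by rewrite /r /m; lia.
    rewrite /E cyclic_rowD scalerA /t mulrN.
    by case: bs => ->; rewrite ?mulrNN !mulr1 scaleN1r addrN.
  by rewrite -(rowWG (Ordinal lt_is)) row_sub.
have [T TE] : exists T, WG *m G + b *: W = T *m WG.
  apply/submxP/row_subP=> -[i lt_is]; rewrite linearD linearZ /= row_mul rowWG rowK /=.
  case: i lt_is => [|[|i]] lt_is.
  - suff -> : w 0 *m G *m G + b *: w 0 = w 1 *m G by exact: sWG.
    by rewrite (wG 1) // /w /= !EG (Ep 0 (r * 1).+1 1) // /r; lia.
  - suff -> : w 1 *m G *m G + b *: w 1 = w 2 *m G + (2 * b) *: (w 0 *m G).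
      by rewrite addmx_sub ?scalemx_sub ?sWG.
    rewrite (wG 1) // (wG 2) // /w /= mulmxDl -scalemxAl !EG.
    rewrite (Ep 1 (r * 1).+2 1%N); last by rewrite /r; lia.
    rewrite (Ep (r * 1)%N (r * 2).+1 1%N); last by rewrite /r; lia.
    by apply/matrixP=> x y; rewrite !mxE; ring.
  suff -> : w i.+2 *m G *m G + b *: w i.+2 = w i.+3 *m G + b *: (w i.+1 *m G).
    by rewrite addmx_sub ?scalemx_sub ?sWG //; move: lt_is; lia.
  rewrite !wG // /w /= mulmxDl -scalemxAl !EG.
  rewrite (Ep (r * i.+1).+1 (r * i.+2).+2 1%N); last by rewrite /r; lia.
  rewrite (Ep (r * i.+2)%N (r * i.+3).+1 1%N); last by rewrite /r; lia.
  by apply/matrixP=> x y; rewrite !mxE !exprS; ring.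
pose V : 'M_(s.+1 + s.+1) := col_mx W WG.
pose C := block_mx 0 1%:M (- b%:M) T.
have VG : V *m G = C *m V.
  rewrite mul_col_mx mul_block_col mul0mx mul1mx add0r; congr col_mx.
  by rewrite mulNmx mul_scalar_mx -TE addrC addrK.
have uV : V \in unitmx.
  rewrite -row_full_unit -sub1mx.
  have EV j : (E j <= V)%MS.
    elim: j => [|j IH].
      rewrite (submx_trans _ (_ : W <= V)%MS) //; last by rewrite -addsmxE addsmxSl.
      by have := row_sub 0 W; rewrite rowK.
    by rewrite -EG (submx_trans (submxMr G IH)) // VG submxMl.
  by apply/row_subP=> i; rewrite row1 -(cyclic_row_ord t) EV.
have b0 : b != 0.
  apply/eqP => b0; case: bs; rewrite b0 expr0n /= => /eqP;
    by rewrite eq_sym ?oppr_eq0 oner_eq0.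
pose Z := T - (b + 1)%:M.
pose N : 'M[F]_(s.+1 + s.+1) := block_mx 0 (- b^-1 *: Z) 0 0.
(* The two block rows of the conjugating matrix consist of left eigenvectors,
   for the eigenvalues b and 1, of the companion matrix of (x - 1)(x - b). *)
apply: (@prod_of_conjugate F _ _ (block_mx 0 1%:M (- b%:M) (b + 1)%:M) N).
- apply: conjugate_mx_sym; exists (block_mx (- 1%:M) 1%:M (- b%:M) 1%:M).
    have e : ((b - 1)^-1 *: block_mx 1%:M (- 1%:M) b%:M (- 1%:M)) *m
        block_mx (- 1%:M) 1%:M (- b%:M) (1%:M : 'M[F]_s.+1) = 1%:M.
      rewrite -scalemxAl mulmx_block !(mulmx1, mul1mx, mulNmx, mulmxN) !opprK.
      rewrite scale_block_mx scalar_mx_block; congr block_mx; apply/matrixP=> x y;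
        rewrite !mxE; case: (x == y); rewrite ?mulr1n ?mulr0n; field;
        by rewrite subr_eq0.
    by case: (mulmx1_unit e).
  rewrite !mulmx_block !(mulmx0, mul0mx, addr0, add0r, mulmx1, mul1mx, mulmxN, mulNmx).
  by congr block_mx; rewrite ?mul_scalar_mx; apply/matrixP=> x y;
    rewrite !mxE; case: (x == y); rewrite ?mulr1n ?mulr0n; ring.
- by rewrite /N mulmx_block !(mulmx0, mul0mx, addr0) block_mx0.
have -> : block_mx 0 1%:M (- b%:M) (b + 1)%:M *m (1%:M + N) = C.
  rewrite mulmxDr mulmx1 mulmx_block !(mulmx0, mul0mx, addr0, add0r, mul1mx).
  rewrite add_block_mx !addr0; congr block_mx.
  rewrite mulNmx mul_scalar_mx !scaleNr scalerN opprK scalerA divff //.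
  by rewrite scale1r addrC subrK.
apply: two_involutions_conjugate (two_involutions_cyclic_shift m tt).
by apply: conjugate_mx_sym; exists V.
Qed.

(** * The theorem *)

(** X |-> 1 + u (X - 1) v is multiplicative and maps 1 to 1: it extends X,
    acting on the image of u, by the identity on the kernel of v. *)
Lemma prod_stabilize (F : fieldType) (k m : nat) (g : 'M[F]_k)
    (u : 'M[F]_(m, k)) (v : 'M[F]_(k, m)) :
  v *m u = 1%:M -> prod_two_involutions_one_U2 g ->
  prod_two_involutions_one_U2 (1%:M + u *m (g - 1%:M) *m v).
Proof.
move=> vu; pose f (X : 'M[F]_k) := 1%:M + u *m (X - 1%:M) *m v.
have fM X Y : f X *m f Y = f (X *m Y).
  have e : u *m (X - 1%:M) *m v *m (u *m (Y - 1%:M) *m v)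
      = u *m ((X - 1%:M) *m (Y - 1%:M)) *m v.
    by rewrite -!mulmxA (mulmxA v) vu mul1mx.
  rewrite /f mulmxDl mul1mx mulmxDr mulmx1 e -addrA -!mulmxDl -!mulmxDr.
  rewrite mulmxBr mulmx1 mulmxBl mul1mx; congr (_ + _ *m _ *m _).
  by apply/matrixP=> a b; rewrite !mxE; ring.
have f1 : f 1%:M = 1%:M by rewrite /f subrr mulmx0 mul0mx addr0.
have fI S : involution S -> involution (f S).
  by move=> [_ SS]; apply: involutionP; rewrite -mulmxE fM SS f1.
have fU U : U2_matrix U -> U2_matrix (f U).
  move=> [_ UU]; apply: U2_shift.
  by rewrite -!mulmxA (mulmxA v) vu mul1mx (mulmxA (U - _)) UU mul0mx mulmx0.
move=> [S1 [S2 [U [/fI I1 /fI I2 /fU IU gE]]]].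
exists (f S1), (f S2), (f U); split=> //.
by case: gE => ->; [apply: Or31 | apply: Or32 | apply: Or33]; rewrite !fM.
Qed.

Theorem theorem1p9 (F : fieldType) (n : nat) (hn : (1 <= n)%N) (A : 'M[F]_n)
    (hA : A \in unitmx) (hdet : \det A = 1 \/ \det A = -1) :
  prod_two_involutions_one_U2 (block_mx A 0 0 (1%:M : 'M[F]_n)).
Proof.
have [s [p [q [p' [q' [AE pp qq]]]]]] : exists s (p : 'M[F]_(n, s)) q p' q',
    [/\ A = 1%:M + p *m q, p' *m p = 1%:M & q *m q' = 1%:M].
  pose D := A - 1%:M.
  exists (\rank D), (col_base D), (row_base D), (pinvmx (col_base D)).
  exists (pinvmx (row_base D)); split.
  - by rewrite mulmx_base addrC subrK.
  - by rewrite mulVpmx // col_base_full.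
  by rewrite mulmxVp // row_base_free.
case: (boolP (is_scalar_mx (1%:M + q *m p))) => [/is_scalar_mxP[b A'b]|nsA'];
  last first.
  rewrite AE; apply: prod_of_factorable_compression pp qq _; rewrite -?AE //.
  apply: unipotent_factorization nsA'.
  by rewrite unitmxE -det_add1_mulmxC -AE -unitmxE.
have qp : q *m p = (b - 1)%:M.
  by rewrite raddfB /= -A'b addrC addKr.
case: (eqVneq (q *m p) 0) => [qp0|qpN0].
  exists 1%:M, 1%:M, (block_mx A 0 0 1%:M).
  have I1 : involution (1%:M : 'M[F]_(n + n)) by apply: involutionP; rewrite mulr1.
  split=> //; last by apply: Or31; rewrite !mul1mx.
  have -> : block_mx A 0 0 (1%:M : 'M_n) = 1%:M + block_mx (p *m q) 0 0 0.
    by rewrite scalar_mx_block add_block_mx !addr0 -AE.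
  apply: U2_shift; rewrite mulmx_block !(mulmx0, mul0mx, addr0).
  by rewrite -mulmxA (mulmxA q) qp0 mul0mx mulmx0 block_mx0.
case: s => [|s] in p q p' q' AE pp qq A'b qp qpN0 *.
  by rewrite [q]flatmx0 mul0mx eqxx in qpN0.
have b1 : b != 1.
  by apply: contra_neq qpN0 => b1; rewrite qp b1 subrr raddf0.
have bs : b ^+ s.+1 = 1 \/ b ^+ s.+1 = -1.
  by rewrite -det_scalar -A'b -det_add1_mulmxC -AE.
have := prod_scalar_block b1 bs; pose c := (b - 1)^-1.
have c1 : c * (b - 1) = 1 by rewrite mulVf // subr_eq0.
have cqp : c *: q *m p = 1%:M by rewrite -scalemxAl qp scale_scalar_mx c1.
move=> /(@prod_stabilize _ _ _ _
  (block_mx p 0 0 p) (block_mx (c *: q) 0 0 (c *: q))).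
have -> : 1%:M + block_mx p 0 0 p *m (block_mx b%:M 0 0 1%:M - 1%:M) *m
    block_mx (c *: q) 0 0 (c *: q) = block_mx A 0 0 (1%:M : 'M_n).
  have -> : block_mx b%:M 0 0 1%:M - 1%:M
      = block_mx (b - 1)%:M 0 0 (0 : 'M[F]_s.+1) :> 'M_(s.+1 + s.+1).
    by rewrite [1%:M in X in _ - X]scalar_mx_block opp_block_mx add_block_mx
      !oppr0 !addr0 subrr raddfB.
  rewrite !mulmx_block !(mulmx0, mul0mx, addr0) mul_mx_scalar.
  rewrite -scalemxAl -scalemxAr scalerA mulrC c1 scale1r scalar_mx_block.
  by rewrite add_block_mx !addr0 -AE.
apply; rewrite mulmx_block !(mulmx0, mul0mx, addr0, add0r) cqp.
by rewrite -scalar_mx_block.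
Qed.
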